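(* For all integers $n \geq 1$ and $0 \leq k \leq n-1$, $$\sum_{(\sigma,S)\in \mathfrak{S}^{>}_{n,k}} q^{\operatorname{inv}((\sigma,S))} = \sum_{(\sigma,S)\in \mathfrak{S}^{>}_{n,k}} q^{\operatorname{maj}((\sigma,S))} = \sum_{P\in\mathcal{M}_{n,k}} q^{\operatorname{unc}(P)} = [n-k]_q!\,S_{n,n-k}(q).$$
   Context: $\mathfrak{S}_n$ is the set of permutations $\sigma=\sigma_1\cdots\sigma_n$ of $\{1,\dots,n\}$. For $\sigma\in\mathfrak{S}_n$: $\operatorname{Des}(\sigma)=\{i\in\{1,\dots,n-1\}:\sigma_i>\sigma_{i+1}\}$, $\operatorname{maj}(\sigma)=\sum_{i\in\operatorname{Des}(\sigma)}i$, $\operatorname{inv}(\sigma)=|\{(i,j):1\le i<j\le n,\ \sigma_i>\sigma_j\}|$, and $\operatorname{inv}^{\Box,j}(\sigma)=|\{i: 1\le i<j,\ \sigma_i>\sigma_j\}|$. $\mathfrak{S}^{>}_{n,k}=\{(\sigma,S):\sigma\in\mathfrak{S}_n,\ S\subseteq\operatorname{Des}(\sigma),\ |S|=k\}$ (descent-starred permutations). For $(\sigma,S)\in\mathfrak{S}^{>}_{n,k}$, $$\operatorname{inv}((\sigma,S))=\operatorname{inv}(\sigma)-\sum_{i\in S}\big(1+\operatorname{inv}^{\Box,i}(\sigma)\big),\qquad \operatorname{maj}((\sigma,S))=\operatorname{maj}(\sigma)-\sum_{i\in S}|\operatorname{Des}(\sigma)\cap\{i,i+1,\dots,n-1\}|.$$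 Mixed rook placements. Let $St_n$ be the board whose $i$th column (from left, $i=1,\dots,n$) consists of $i$ cells, columns being bottom-justified and rows numbered $1,2,\dots$ from the bottom. $\mathcal{M}_{n,k}$ is the set of all placements $P=N\cup F$ of rooks in cells of $St_n$, where $N$ consists of $k$ rooks (''non-attacking rooks'') and $F$ consists of $n-k$ rooks (''file rooks'') (the type of each rook is part of the data), such that: (1) no rook of $N$ is in the first (bottom) row; (2) there is exactly one rook in each column; (3) each rook $r\in N$ cancels the cell it occupies, all cells in its row to the right of $r$, and all cells in its column that either lie above $r$ or lie in the first row; (4) each rook $f\in F$ cancels the cell it occupies and all cells in its column above $f$; (5) no rook lies in a cell canceled by another rook. In particular no two rooks of $N$ share a row or column. For $P\in\mathcal{M}_{n,k}$, $\operatorname{unc}(P)$ is the number of cells of $St_n$ not canceled by any rook of $P$. $[m]_q=1+q+\cdots+q^{m-1}$ and $[m]_q!=[1]_q[2]_q\cdots[m]_q$. The $q$-Stirling numbers $S_{n,k}(q)$ are defined by $S_{0,0}(q)=1$, $S_{n,k}(q)=0$ if $k<0$ or $k>n$, and $S_{n+1,k}(q)=S_{n,k-1}(q)+[k]_qS_{n,k}(q)$. *)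

(* Defs.v *)
From HB Require Import structures.
From mathcomp Require Import all_boot all_order all_fingroup all_algebra.

Set Implicit Arguments.
Unset Strict Implicit.
Unset Printing Implicit Defensive.

Import GRing.Theory.

(* Positions, values, rows and columns are 0-based: the
   ordinal [i : 'I_n] stands for the integer [i.+1] of {1, ..., n}. *)

Definition Des n (s : 'S_n) : {set 'I_n} :=
  [set i : 'I_n | [exists j : 'I_n, (j == i.+1 :> nat) && (s j < s i)]].

Definition maj n (s : 'S_n) : nat := \sum_(i in Des s) i.+1.

Definition perm_inv n (s : 'S_n) : nat :=
  #|[set p : 'I_n * 'I_n | (p.1 < p.2) && (s p.2 < s p.1)]|.

Definition inv_box n (s : 'S_n) (j : 'I_n) : nat :=
  #|[set i : 'I_n | (i < j) && (s j < s i)]|.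

Definition des_from n (s : 'S_n) (i : 'I_n) : nat :=
  #|[set j in Des s | i <= j]|.

Definition starred (n k : nat) : {set 'S_n * {set 'I_n}} :=
  [set p : 'S_n * {set 'I_n} | (p.2 \subset Des p.1) && (#|p.2| == k)].

(* The subtractions below are on [nat]; they are never truncated on
   descent-starred permutations, by [starred_inv_le] and [starred_maj_le]. *)
Definition starred_inv n (p : 'S_n * {set 'I_n}) : nat :=
  perm_inv p.1 - \sum_(i in p.2) (1 + inv_box p.1 i).

Definition starred_maj n (p : 'S_n * {set 'I_n}) : nat :=
  maj p.1 - \sum_(i in p.2) des_from p.1 i.

Lemma inv_sum_box n (s : 'S_n) : perm_inv s = \sum_j inv_box s j.
Proof.
rewrite /perm_inv -sum1_card (reindex_inj (h := fun p => (p.2, p.1))) /=; last first.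
  by move=> [a b] [c d] [-> ->].
rewrite (eq_bigl (fun p : 'I_n * 'I_n => true && ((p.2 < p.1) && (s p.1 < s p.2)))).
  rewrite -(pair_big_dep xpredT (fun j i : 'I_n => (i < j) && (s j < s i))
             (fun _ _ => 1)) /=.
  apply: eq_bigr => j _; rewrite /inv_box -sum1_card.
  by apply: eq_bigl => i; rewrite inE.
by move=> p; rewrite inE.
Qed.

Lemma starred_inv_le n k p : p \in starred n k ->
  \sum_(i in p.2) (1 + inv_box p.1 i) <= perm_inv p.1.
Proof.
case: p => s S; rewrite inE /= => /andP[/subsetP sub _].
have nextP (i : 'I_n) : i \in S ->
    exists2 j : 'I_n, j = i.+1 :> nat & s j < s i.
  by move=> /sub; rewrite inE => /existsP[j /andP[/eqP ? ?]]; exists j.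
pose nx (i : 'I_n) : 'I_n := insubd i i.+1.
have nxE i : i \in S -> nx i = i.+1 :> nat /\ s (nx i) < s i.
  move=> /nextP[j ji lt]; suff -> : nx i = j by [].
  by apply: val_inj; rewrite val_insubd /= -ji ltn_ord.
have nx_inj : {in S &, injective nx}.
  move=> i j /nxE[ei _] /nxE[ej _] eq; apply: val_inj.
  by move: ei; rewrite eq ej => -[].
rewrite inv_sum_box; apply: (@leq_trans (\sum_(i in S) inv_box s (nx i))).
  apply: leq_sum => i /nxE[ei lt]; rewrite add1n /inv_box.
  apply: proper_card; apply/properP; split.
    apply/subsetP => a; rewrite !inE ei => /andP[ai la].
    by rewrite (ltn_trans ai (ltnSn i)) (ltn_trans lt la).
  by exists i; rewrite !inE ?ltnn ?ei ?ltnSn ?lt.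
rewrite -(big_imset (inv_box s) nx_inj) /= [leqRHS](bigID (mem (nx @: S))) /=.
exact: leq_addr.
Qed.

Lemma starred_maj_le n k p : p \in starred n k ->
  \sum_(i in p.2) des_from p.1 i <= maj p.1.
Proof.
case: p => s S; rewrite inE /= => /andP[sub _].
apply: (@leq_trans (\sum_(i in Des s) des_from s i)).
  rewrite [leqRHS](bigID (mem S)) /=.
  rewrite [X in _ <= X + _](eq_bigl (mem S)) ?leq_addr // => i /=.
  by apply: andb_idl => /(subsetP sub).
rewrite (eq_bigr (fun i : 'I_n => \sum_(j in Des s | i <= j) 1)); last first.
  move=> i _; rewrite /des_from -sum1_card.
  by apply: eq_bigl => j; rewrite inE.
rewrite (exchange_big_dep (mem (Des s))) /=; last by move=> ? ? _ /andP[].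
apply: leq_sum => j _; rewrite sum1_card.
apply: (@leq_trans #|[set widen_ord (ltn_ord j) i | i in 'I_j.+1]|).
  apply: subset_leq_card; apply/subsetP => i; rewrite unfold_in /= => /and3P[_ _ ij].
  by apply/imsetP; exists (Ordinal (n := j.+1) ij) => //; apply: val_inj.
by rewrite (leq_trans (leq_imset_card _ _)) ?card_ord.
Qed.

(* A cell is a pair (column, row), rows counted from the bottom. *)
Definition cell n : finType := ('I_n * 'I_n)%type.

Definition St n : {set cell n} := [set c : cell n | c.2 <= c.1].

(* A rook is tagged [true] if it is non-attacking, [false] if it is a file
   rook. *)
Definition rook n : finType := (bool * cell n)%type.

Definition cancels n (r : rook n) (c : cell n) : bool :=
  let: (nonattacking, (i, j)) := r in
  if nonattacking then
    [|| c == (i, j), (c.2 == j) && (i < c.1)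
      | (c.1 == i) && ((j < c.2) || (c.2 == 0 :> nat))]
  else (c == (i, j)) || (c.1 == i) && (j < c.2).

Definition mixed_placements (n k : nat) : {set {set rook n}} :=
  [set P : {set rook n} |
    [&& [forall r in P, r.2 \in St n],
        #|[set r in P | r.1]| == k,
        #|[set r in P | ~~ r.1]| == n - k,
        [forall r in P, r.1 ==> (r.2.2 != 0 :> nat)],
        [forall i : 'I_n, #|[set r in P | r.2.1 == i]| == 1]
      & [forall r in P, forall r' in P, (r != r') ==> ~~ cancels r r'.2]]].

Definition unc n (P : {set rook n}) : nat :=
  #|[set c in St n | [forall r in P, ~~ cancels r c]]|.

Local Open Scope ring_scope.

(* The variable [q] is the indeterminate ['X]. *)
Definition qint m : {poly int} := \sum_(i < m) 'X^i.

Definition qfact m : {poly int} := \prod_(1 <= i < m.+1) qint i.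

(* The recurrence is used with the convention that the coefficient vanishes for
   a negative second index; it then also vanishes for [k > n]. *)
Fixpoint qStirling n k : {poly int} :=
  match n, k with
  | 0, 0 => 1
  | 0, _.+1 => 0
  | n'.+1, 0 => qint 0 * qStirling n' 0
  | n'.+1, k'.+1 => qStirling n' k' + qint k * qStirling n' k
  end.

(* Main.v *)
Require Import Defs.
From HB Require Import structures.
From mathcomp Require Import all_boot all_order all_fingroup all_algebra.
From mathcomp Require Import ring zify.

Set Implicit Arguments.
Unset Strict Implicit.
Unset Printing Implicit Defensive.

Import GRing.Theory.
Local Open Scope ring_scope.

(* With a(n, k) = [n-k]! S(n, n-k), the recurrence of the q-Stirling numbers
   reads a(n+1, k) = [n+1-k] (a(n, k) + a(n, k-1)).  Rook placements satisfy it
   by choosing the rook of the last column: a file rook for the first summand,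
   a non-attacking rook for the second.
   For permutations, the sum over the sets of stars of a fixed s is
   G_s(z) = q^(stat s) prod_(i in Des s) (1 + z / q^(c_i)), where z marks the
   stars.  Multiplied by q - 1, the recurrence says that the generating
   function A_n(z) = sum_k a(n, k) z^k satisfies
     (q - 1) A_(n+1)(z) = q^(n+1) (1 + z/q) A_n(z/q) - (1 + z) A_n(z),
   and for both statistics the same identity already holds between G_s and the
   sum of the G_t over the t obtained by inserting the new maximum in s: the
   sum over the insertion positions telescopes. *)

(** * Rook placements *)

(* A placement is encoded by the perm_word whose [i]th letter [(b, j)] is the type
   and the row of the rook in column [i]. *)
Definition allowed (w : seq (bool * nat)) (x : bool * nat) : bool :=
  [&& (x.2 <= size w)%N, x.1 ==> (x.2 != 0%N) & (true, x.2) \notin w].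

(** The predicate serves twice: for [j <= size w] it decides whether [(b, j)] is [allowed] after
    [w], and below row [j] it selects the cells left uncancelled. This is why a column contributes a
    q-integer. *)
Definition free_row (w : seq (bool * nat)) (b : bool) : pred nat :=
  [pred y | ((true, y) \notin w) && (b ==> (y != 0%N))].

Definition col_unc (w : seq (bool * nat)) (x : bool * nat) : nat :=
  count (free_row w x.1) (iota 0 x.2).

Definition rook_unc (w : seq (bool * nat)) : nat :=
  (\sum_(i < size w) col_unc (take i w) (nth (false, 0) w i))%N.

Definition letters n : seq (bool * nat) :=
  [seq (b, j) | b <- [:: true; false], j <- iota 0 n].
Arguments letters : simpl never.

Fixpoint rook_words n : seq (seq (bool * nat)) :=
  if n is m.+1 then
    [seq rcons w x | w <- rook_words m,
       x <- [seq x <- letters m.+1 | allowed w x]]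
  else [:: [::]].

Lemma mem_letters n (x : bool * nat) :
  (x \in letters n) = (x.2 < n)%N.
Proof.
case: x => b j; apply/allpairsP/idP => /=.
  by case=> -[b' j'] /= [_]; rewrite mem_iota add0n => /andP[_ h] [_ ->].
by move=> jn; exists (b, j); split; rewrite ?mem_iota //; case: b.
Qed.

Lemma rook_words_rcons n (w : seq (bool * nat)) x :
  (rcons w x \in rook_words n.+1)
  = (w \in rook_words n) && (allowed w x && (x.2 <= n)%N).
Proof.
apply/allpairsPdep/idP => [[w' [x' [w'n]]]|/andP[wn /andP[ax xn]]].
  rewrite mem_filter mem_letters ltnS => ax' /rcons_inj[-> ->].
  by rewrite w'n ax'.
exists w, x; split=> //; rewrite mem_filter ax mem_letters //.
Qed.

Lemma size_rook_words n (w : seq (bool * nat)) : w \in rook_words n -> size w = n.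
Proof.
elim: n w => [|n IH] w; first by rewrite inE => /eqP->.
by move=> /allpairsPdep[w' [x [/IH sw' _ ->]]]; rewrite size_rcons sw'.
Qed.

Lemma uniq_rook_words n : uniq (rook_words n).
Proof.
elim: n => [|n IH] //; apply: allpairs_uniq_dep => //.
  move=> w _; apply/filter_uniq/allpairs_uniq => //; first exact: iota_uniq.
  by move=> [? ?] [? ?].
by move=> [w x] [w' x'] _ _ /= /rcons_inj[-> ->].
Qed.

Lemma rook_wordsP n (w : seq (bool * nat)) :
  reflect (size w = n /\
      forall i, (i < n)%N -> allowed (take i w) (nth (false, 0%N) w i))
    (w \in rook_words n).
Proof.
elim: n w => [|n IH] w.
  rewrite inE; apply: (iffP eqP) => [-> //|[]].
  by case: w.
case: (lastP w) => [|{}w x].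
  by apply: (iffP idP) => [/size_rook_words //|[]].
rewrite rook_words_rcons; apply: (iffP idP) => [/andP[/IH[sw aw] /andP[ax xn]]|].
  split=> [|i]; first by rewrite size_rcons sw.
  rewrite ltnS leq_eqVlt nth_rcons sw -cats1 take_cat sw => /predU1P[->|lt_in].
    by rewrite ltnn eqxx subnn take0 cats0.
  by rewrite lt_in; apply: aw.
rewrite size_rcons => -[[sw] aw]; apply/andP; split.
  apply/IH; split=> // i lt_in; have := aw i (leqW lt_in).
  by rewrite nth_rcons sw lt_in -cats1 take_cat sw lt_in.
have := aw n (ltnSn n).
rewrite nth_rcons sw ltnn eqxx -cats1 take_cat sw ltnn subnn take0 cats0 => ax.
by rewrite ax; case/and3P: ax; rewrite sw.
Qed.

(** * Counting rook words column by column *)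

Lemma qintS m : qint m.+1 = qint m + 'X^m.
Proof. by rewrite /qint big_ord_recr. Qed.

Lemma qint0 : qint 0 = 0.
Proof. exact: big_ord0. Qed.

(** The exponent of [j] is its rank among the numbers satisfying [P], so the exponents are 0, 1, 2,
    ..., each taken once. *)
Lemma sum_Xcount (P : pred nat) N :
  \sum_(0 <= j < N | P j) 'X^(count P (iota 0 j)) = qint (count P (iota 0 N)).
Proof.
elim: N => [|N IH]; first by rewrite big_geq // qint0.
rewrite -[in RHS]addn1 iotaD count_cat big_mkcond big_nat_recr //= -big_mkcond IH addn0.
by case: (P N); rewrite ?addn0 ?addr0 // addn1 qintS.
Qed.

Lemma rook_row_pos n (w : seq (bool * nat)) : w \in rook_words n -> (true, 0%N) \notin w.
Proof.
elim: n w => [|n IH] w; first by rewrite inE => /eqP->.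
case: (lastP w) => [//|{}w [b j]]; rewrite rook_words_rcons.
case/andP=> /IH w0 /andP[/and3P[_ bj _] _].
rewrite mem_rcons inE negb_or w0 andbT; apply: contraL bj => /eqP[<- <-] //.
Qed.

Lemma count_rook_rows n (w : seq (bool * nat)) N : w \in rook_words n -> (n <= N)%N ->
  count [pred y | (true, y) \in w] (iota 0 N) = count fst w.
Proof.
elim: n w => [|n IH] w; first by rewrite inE => /eqP-> _; rewrite /= count_pred0.
case: (lastP w) => [/size_rook_words //|{}w [b j]]; rewrite rook_words_rcons.
case/andP=> wn /andP[/and3P[_ bj jw] /= jn] nN.
rewrite -cats1 count_cat -(IH w wn (ltnW nN)) /= addn0.
have -> : count [pred y | (true, y) \in w ++ [:: (b, j)]] (iota 0 N)
  = count (predU [pred y | (true, y) \in w] [pred y | b && (y == j)]) (iota 0 N).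
  by apply: eq_count => y /=; rewrite mem_cat inE.
have := count_predUI [pred y | (true, y) \in w] [pred y | b && (y == j)] (iota 0 N).
(* The two predicates are disjoint: a new non-attacking rook takes an unoccupied row. *)
rewrite [X in (_ + X)%N](_ : _ = 0)%N; last first.
  apply/eqP; rewrite -leqn0 leqNgt -has_count; apply/hasPn => y _ /=.
  by apply/negP => /and3P[h _ /eqP hy]; move: jw; rewrite /= -hy h.
rewrite addn0 => ->; congr addn.
move: jw; case: b {bj} => /= jw; last by rewrite count_pred0.
rewrite (eq_count (a2 := pred1 j)) // count_uniq_mem ?iota_uniq // mem_iota /= add0n.
by rewrite (leq_ltn_trans jn nN).
Qed.

(** Non-attacking rooks occupy distinct rows, none of them row 0, so the rows they cancel and the
    bottom row, lost when [b] holds, are disjoint losses. *)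
Lemma count_free_row n (w : seq (bool * nat)) b : w \in rook_words n ->
  count (free_row w b) (iota 0 n.+1) = (n.+1 - b - count fst w)%N.
Proof.
move=> wn; have := count_predC [pred y | (true, y) \in w] (iota 0 n.+1).
rewrite (count_rook_rows wn (leqnSn n)) size_iota.
have w0 := rook_row_pos wn.
have -> : count (predC [pred y | (true, y) \in w]) (iota 0 n.+1)
  = (1 + count (free_row w b) (iota 1 n))%N.
  rewrite /= w0; congr addn; apply: eq_in_count => y.
  by rewrite mem_iota; case: y => [|y] // _; rewrite /free_row; case: b; rewrite /= andbT.
rewrite /= {2}/free_row; case: b; rewrite /= w0 /= => h; lia.
Qed.

Lemma rook_unc_rcons w x : rook_unc (rcons w x) = (rook_unc w + col_unc w x)%N.
Proof.
rewrite /rook_unc size_rcons big_ord_recr /= nth_rcons ltnn eqxx -cats1 take_size_cat //.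
congr addn; apply: eq_bigr => i _.
by rewrite nth_cat ltn_ord take_cat ltn_ord.
Qed.

Definition rook_sum n k : {poly int} :=
  \sum_(w <- rook_words n | count fst w == k) 'X^(rook_unc w).

(** A last file rook after [k] non-attacking rooks has n+1-k free rows; a last non-attacking rook
    after k-1 of them has (n+1)-1-(k-1), the same number. *)
Lemma rook_sumS n k : rook_sum n.+1 k =
  qint (n.+1 - k) * rook_sum n k
  + (if k is k'.+1 then qint (n - k') * rook_sum n k' else 0).
Proof.
rewrite /rook_sum big_mkcond big_allpairs_dep.
transitivity (\sum_(w <- rook_words n)
   ((if count fst w == k then 'X^(rook_unc w) * qint (n.+1 - k) else 0)
   + (if (count fst w).+1 == k then 'X^(rook_unc w) * qint (n.+1 - k) else 0)) : {poly int}).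
  rewrite big_seq [RHS]big_seq; apply: eq_bigr => w wn.
  rewrite big_filter [LHS]big_mkcond /letters big_allpairs_dep big_cons big_seq1 /= addrC.
  have col b : \sum_(j <- iota 0 n.+1) (if allowed w (b, j) then
        if count fst (rcons w (b, j)) == k then 'X^(rook_unc (rcons w (b, j))) else 0
      else 0)
    = (if (count fst w + b)%N == k then 'X^(rook_unc w) * qint (n.+1 - k) else 0)
    :> {poly int}.
    have -> : qint (n.+1 - k) = 0 + qint (n.+1 - k) by rewrite add0r.
    case: eqP => [kE|kN]; last first.
      apply: big1 => j _; case: ifP => // _.
      rewrite -cats1 count_cat /= addn0; case: eqP => // /kN //.
    (* With [k] equal to [count fst w + b], the q-integer is that of the number of free rows and
       expands as a sum over them. *)
    rewrite add0r -kE addnC subnDA -(count_free_row b wn) -sum_Xcount mulr_sumr.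
    rewrite [RHS]big_mkcond /index_iota subn0 big_seq [RHS]big_seq; apply: eq_bigr => j.
    rewrite mem_iota add0n ltnS /= => jn.
    rewrite -cats1 count_cat /= addn0 addnC eqxx cats1 rook_unc_rcons exprD.
    by rewrite /allowed (size_rook_words wn) jn /= andbC.
  by congr (_ + _); [have := col false|have := col true]; rewrite ?addn0 ?addn1.
rewrite big_split /= -big_mkcond -mulr_suml mulrC; congr (_ + _).
case: k => [|k]; first by rewrite big1.
by rewrite -big_mkcond -mulr_suml mulrC.
Qed.

Lemma rook_sum_gt n k : (n < k)%N -> rook_sum n k = 0.
Proof.
move=> nk; rewrite /rook_sum big_seq_cond big1 // => w /andP[/size_rook_words sw /eqP kE].
by have := count_size fst w; rewrite sw kE leqNgt nk.
Qed.

Lemma qStirling_gt n k : (n < k)%N -> qStirling n k = 0.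
Proof.
elim: n k => [|n IH] [|k] //= nk.
by rewrite !IH ?mulr0 ?addr0 // ltnW.
Qed.

Lemma qfactS m : qfact m.+1 = qfact m * qint m.+1.
Proof. by rewrite /qfact big_nat_recr. Qed.

(** The recurrence of S(n+1, n+1-k) multiplied by [n+1-k]! is [rook_sumS]. At k = 0 the surplus term
    contains S(n, n+1) = 0; at k = n+1 both sides vanish with [0] = 0. *)
Lemma rook_sumE n k : (k <= n)%N -> rook_sum n k = qfact (n - k) * qStirling n (n - k).
Proof.
elim: n k => [|n IH] k kn.
  move: kn; rewrite leqn0 => /eqP->.
  by rewrite /rook_sum big_cons big_nil /= addr0 /rook_unc big_ord0 /qfact big_geq // mulr1.
rewrite rook_sumS; case: k kn => [_|k].
  rewrite !subn0 IH // subn0 addr0 /= (qStirling_gt (ltnSn n)) mulr0 addr0 qfactS; ring.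
rewrite ltnS subSS => kn; rewrite (IH k kn).
case: (ltngtP k n) kn => // [kn|->] _; last first.
  by rewrite subnn qint0 !mul0r /= qint0 mul0r mulr0 addr0.
rewrite IH // -(subnSK kn) /= qfactS; ring.
Qed.

(** * Bijection between rook words and mixed placements *)

Definition placement n (w : seq (bool * nat)) : {set rook n} :=
  [set r : rook n | nth (false, 0%N) w r.2.1 == (r.1, val r.2.2)].

Lemma rook_row_le n (w : seq (bool * nat)) i : w \in rook_words n -> (i < n)%N ->
  ((nth (false, 0) w i).2 <= i)%N.
Proof.
by move=> /rook_wordsP[sw aw] ilt; have /and3P[] := aw i ilt; rewrite size_takel // sw ltnW.
Qed.

(** On a rook word the default of [insubd] is never taken, since the row of letter [i] is at most
    [i]. *)
Definition letter_rook n (w : seq (bool * nat)) (i : 'I_n) : rook n :=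
  ((nth (false, 0%N) w i).1, (i, insubd i (nth (false, 0%N) w i).2)).

Lemma mem_placement n w (r : rook n) : w \in rook_words n ->
  (r \in placement n w) = (r == letter_rook w r.2.1).
Proof.
move=> wn; case: r => b [i j]; rewrite inE /letter_rook /= !xpair_eqE eqxx /=.
have := rook_row_le wn (ltn_ord i); case: (nth _ w i) => b' j' /= j'i.
rewrite xpair_eqE [b == _]eq_sym -[j == _]val_eqE val_insubd.
by rewrite (leq_ltn_trans j'i) // [j' == _]eq_sym.
Qed.

Lemma letter_rook_inj n w : injective (@letter_rook n w).
Proof. by move=> i j [_ ->]. Qed.

Lemma val_letter_row n w (i : 'I_n) : w \in rook_words n ->
  val (letter_rook w i).2.2 = (nth (false, 0%N) w i).2.
Proof.
move=> wn; rewrite val_insubd.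
by rewrite (leq_ltn_trans (rook_row_le wn (ltn_ord i))).
Qed.

Lemma count_nth T (x0 : T) (P : pred T) s :
  count P s = #|[set i : 'I_(size s) | P (nth x0 s i)]|.
Proof.
rewrite -sum1_count (big_nth x0) big_mkord -sum1_card.
by apply: eq_bigl => i; rewrite inE.
Qed.

Lemma card_placement n w (P : pred bool) : w \in rook_words n ->
  #|[set r in placement n w | P r.1]| = count (P \o fst) w.
Proof.
move=> wn; have sw := size_rook_words wn; rewrite (count_nth (false, 0%N)).
(* Eliminating [sw] turns ['I_n] into ['I_(size w)], the index type in [count_nth]. *)
move: wn; case: _ / sw => wn.
rewrite -(card_imset _ (@letter_rook_inj _ w)); congr #|pred_of_set _|; apply/setP => r.
rewrite inE mem_placement //; apply/andP/imsetP.
  by case=> /eqP rE Pr; exists r.2.1 => //; rewrite inE; move: Pr; rewrite {1}rE.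
by case=> i; rewrite inE /= => Pi ->.
Qed.

Lemma placement_inj n : {in rook_words n &, injective (placement n)}.
Proof.
move=> w w' wn w'n eqw; apply: (@eq_from_nth _ (false, 0%N)).
  by rewrite (size_rook_words wn) (size_rook_words w'n).
rewrite (size_rook_words wn) => i ilt.
have: letter_rook w (Ordinal ilt) \in placement n w' by rewrite -eqw mem_placement.
rewrite mem_placement // => /eqP => e.
have := val_letter_row (Ordinal ilt) wn; have := val_letter_row (Ordinal ilt) w'n.
rewrite -e; move: e => [/= e _] /= -> e2.
by case: (nth _ w i) (nth _ w' i) e e2 => ? ? [? ?] /= -> ->.
Qed.

Lemma mem_take_nth (T : eqType) (x0 x : T) s i : (i <= size s)%N ->
  reflect (exists2 j, (j < i)%N & nth x0 s j = x) (x \in take i s).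
Proof.
move=> si; apply: (iffP (nthP x0)); rewrite size_takel //.
  by case=> j ji <-; exists j; rewrite ?nth_take.
by case=> j ji <-; exists j; rewrite ?nth_take.
Qed.

Lemma allowedP (w : seq (bool * nat)) i : (i < size w)%N ->
  reflect [/\ ((nth (false, 0) w i).2 <= i)%N,
              (nth (false, 0%N) w i).1 -> (nth (false, 0%N) w i).2 <> 0%N
            & forall i', (i' < i)%N -> (nth (false, 0%N) w i').1 ->
                (nth (false, 0%N) w i').2 <> (nth (false, 0%N) w i).2]
    (allowed (take i w) (nth (false, 0%N) w i)).
Proof.
move=> iw; rewrite /allowed (size_takel (ltnW iw)).
apply: (iffP and3P) => [[h0 /implyP h1 h2]|[h0 h1 h2]]; split=> //.
- by move=> /h1/eqP.
- move=> i' i'i b' e; case/negP: h2; apply/(mem_take_nth (false, 0%N)); first exact: ltnW.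
  by exists i' => //; rewrite -e; move: b'; case: (nth _ w i') => /= ? ? ->.
- by apply/implyP => /h1/eqP.
- apply/negP => /(mem_take_nth (false, 0%N) _ (ltnW iw))[i' i'i e].
  by apply: (h2 i' i'i); rewrite e.
Qed.

Lemma cancels_letter n w (i : 'I_n) (c : cell n) : w \in rook_words n ->
  cancels (letter_rook w i) c =
    let: (b, j) := nth (false, 0%N) w i in
    if b then [|| (c.1 == i) && (c.2 == j :> nat), (c.2 == j :> nat) && (i < c.1)%N
               | (c.1 == i) && ((j < c.2)%N || (c.2 == 0%N :> nat))]
    else (c.1 == i) && (j <= c.2)%N.
Proof.
move=> wn; have := val_letter_row i wn; rewrite /letter_rook /=.
case: (nth _ w i) => b j /= jE; case: c => c y; rewrite /cancels !xpair_eqE /=.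
rewrite -[y == _]val_eqE /= jE; case: b => //.
by rewrite -andb_orr [in RHS](leq_eqVlt j) [j == y]eq_sym.
Qed.

(** Rook words have all the conditions built in except the number of non-attacking rooks. Rooks in
    different columns interact only along the row of a non-attacking rook on the left, which
    [allowed] excludes. *)
Lemma placement_mixed n k w : w \in rook_words n ->
  (placement n w \in mixed_placements n k) = (count fst w == k).
Proof.
move=> wn; have [sw aw] := rook_wordsP _ _ wn.
have inP r : r \in placement n w -> exists i, r = letter_rook w i.
  by rewrite mem_placement // => /eqP ->; exists r.2.1.
have iw (i : 'I_n) : (i < size w)%N by rewrite sw.
have {}aw i := allowedP (iw i) (aw i (ltn_ord i)).
rewrite inE (card_placement id wn) (card_placement negb wn).
rewrite (_ : count (id \o fst) w = count fst w) //.
have [wk|] := eqVneq (count fst w) k; last by rewrite andbF.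
have -> : count (negb \o fst) w = (n - k)%N.
  by rewrite -sw -(count_predC fst) wk addKn.
rewrite eqxx /=; apply/and4P; split.
- apply/forall_inP => r /inP[i ->]; rewrite inE val_letter_row //.
  exact: rook_row_le (ltn_ord i).
- apply/forall_inP => r /inP[i ->]; rewrite val_letter_row //.
  by apply/implyP => b; have [_ h _] := aw i; apply/eqP/h.
- apply/forallP => i; apply/cards1P; exists (letter_rook w i); apply/setP=> r.
  rewrite inE [RHS]in_set1 mem_placement //.
  by apply/andP/eqP => [[/eqP rE /eqP<-]|->].
apply/forall_inP => r /inP[i ->]; apply/forall_inP => r' /inP[i' ->].
apply/implyP; rewrite (inj_eq (@letter_rook_inj _ _)) => ii'.
rewrite cancels_letter // val_letter_row //=.
rewrite eq_sym (negbTE ii') /=.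
have [_ _ /(_ i)] := aw i'.
case: (nth _ w i) => -[] j //= h.
by rewrite orbF; apply/negP=> /andP[/eqP e lt]; apply: (h lt isT).
Qed.

(** Each column contains exactly one rook [f i]; the word lists their types and rows from left to
    right. *)
Lemma mixed_placementP n k (P : {set rook n}) : P \in mixed_placements n k ->
  exists2 w, w \in rook_words n & P = placement n w.
Proof.
rewrite inE => /and5P[/forall_inP Pst _ _ /forall_inP P0].
case/andP=> /forallP Pcol /forall_inP Pc.
have /fin_all_exists[f fP] i := cards1P (Pcol i).
have fin i : f i \in P /\ (f i).2.1 = i.
  have : f i \in [set r in P | r.2.1 == i] by rewrite fP inE.
  by rewrite inE => /andP[? /eqP].
have Pf r : r \in P -> r = f r.2.1.
  by move=> rP; apply/set1P; rewrite -fP inE rP eqxx.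
pose w := [seq ((f i).1, val (f i).2.2) | i : 'I_n].
have sw : size w = n by rewrite size_map size_enum_ord.
have wE (i : 'I_n) : nth (false, 0%N) w i = ((f i).1, val (f i).2.2).
  by rewrite (nth_map i) ?size_enum_ord // nth_ord_enum.
exists w; last first.
  apply/setP => r; rewrite inE wE xpair_eqE val_eqE.
  apply/idP/andP => [rP|[/eqP e1 /eqP e2]]; first by rewrite -(Pf _ rP).
  suff rE : f r.2.1 = r by rewrite -rE; have [] := fin r.2.1.
  by case: r e1 e2 (fin r.2.1) => b [i j] /=; case: (f i) => ? [? ?] /= -> -> [_ ->].
apply/rook_wordsP; split=> // i ilt; pose o := Ordinal ilt.
have [oP o1] := fin o.
apply/allowedP; first by rewrite sw.
rewrite (wE o) /=; split.
- by have := Pst _ oP; rewrite inE o1.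
- by move=> b; have := P0 _ oP; rewrite b => /eqP.
move=> i' i'i; pose o' := Ordinal (ltn_trans i'i ilt); rewrite (wE o') /= => b e.
have [o'P o'1] := fin o'.
(* In the same row, the non-attacking rook [f o'] of the earlier column would cancel the cell of
   [f o]. *)
have := Pc _ o'P => /forall_inP/(_ _ oP)/implyP.
have -> : f o' != f o.
  apply/eqP=> h; move: o'1; rewrite h o1 => /(congr1 val) /= ei.
  by move: (i'i); rewrite ei ltnn.
move/(_ isT); apply/negP; rewrite negbK.
move: b e o'1 o1; case: (f o') => _ [_ y] /= -> e ->; case: (f o) e => ? [? ?] /= e ->.
by rewrite /cancels /= -[_ == y]val_eqE /= e eqxx i'i orbT.
Qed.

(** The rook of the column of [c] cancels everything from its row upwards and, if non-attacking, the
    bottom cell; other columns act only through non-attacking rooks on the left. A cell below the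
    rook is on the board because the rook is. *)
Lemma uncancelled_placement n w (c : cell n) : w \in rook_words n ->
  (c \in St n) && [forall r in placement n w, ~~ cancels r c]
  = free_row (take c.1 w) (nth (false, 0%N) w c.1).1 c.2
      && (c.2 < (nth (false, 0%N) w c.1).2)%N.
Proof.
move=> wn; have [sw aw] := rook_wordsP _ _ wn.
case: c => i y; rewrite inE /=.
have iw : (i <= size w)%N by rewrite sw ltnW.
have ri := rook_row_le wn (ltn_ord i).
have lP (i' : 'I_n) : letter_rook w i' \in placement n w by rewrite mem_placement.
apply/andP/andP => -[].
  move=> yi /forall_inP unc; have := unc _ (lP i).
  rewrite cancels_letter //= eqxx.
  move: ri; case E: (nth _ w i) => [b j] /= ji ui; split; last first.
    by case: b ui {E} => /=; lia.
  apply/andP; split; last by case: b ui {E} => //=; lia.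
  apply/negP => /(mem_take_nth (false, 0%N) _ iw)[i' i'i e].
  have := unc _ (lP (Ordinal (ltn_trans i'i (ltn_ord i)))).
  by rewrite cancels_letter //= e eqxx i'i orbT.
move: ri; case E: (nth _ w i) => [b j] /= ji /andP[yw by0] yj; split; first by lia.
apply/forall_inP => r; rewrite mem_placement // => /eqP ->; move: r.2.1 => i'.
rewrite cancels_letter //=.
have [<-|ii'] := eqVneq i i'.
  by rewrite E; case: b by0 {E} => /=; lia.
case E': (nth _ w i') => [[] j'] //=; rewrite orbF.
apply/negP => /andP[/eqP yj' i'i]; case/negP: yw.
by apply/(mem_take_nth (false, 0%N) _ iw); exists i' => //; rewrite E' yj'.
Qed.

Lemma unc_placement n w : w \in rook_words n -> unc (placement n w) = rook_unc w.
Proof.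
move=> wn; have sw := size_rook_words wn; rewrite /unc -sum1_card.
under eq_bigl => c do rewrite in_set uncancelled_placement //.
rewrite -(pair_big_dep xpredT (fun i y : 'I_n => free_row (take i w)
  (nth (false, 0%N) w i).1 y && (y < (nth (false, 0%N) w i).2)%N) (fun _ _ => 1%N)) /=.
rewrite /rook_unc sw; apply: eq_bigr => i _; rewrite /col_unc -sum1_count.
have := rook_row_le wn (ltn_ord i); case: (nth _ w i) => b j /= ji.
have jn : (j <= n)%N := leq_trans ji (ltnW (ltn_ord i)).
rewrite -[X in iota 0 X]subn0 -/(index_iota 0 j) (big_nat_widen _ _ _ _ _ jn) big_mkord.
by apply: eq_bigl => y.
Qed.

Lemma sum_mixed_placements n k :
  \sum_(P in mixed_placements n k) 'X^(unc P) = rook_sum n k.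
Proof.
rewrite /rook_sum -big_filter -[RHS]big_filter.
transitivity (\sum_(P <- [seq placement n w | w <- rook_words n & count fst w == k])
   'X^(unc P) : {poly int}).
  apply/perm_big/uniq_perm; first exact/filter_uniq/index_enum_uniq.
    rewrite map_inj_in_uniq ?filter_uniq ?uniq_rook_words // => w w'.
    rewrite !mem_filter => /andP[_ wn] /andP[_ w'n]; exact: placement_inj.
  move=> P; rewrite mem_filter mem_index_enum andbT; apply/idP/mapP => [PM|[w]].
    have [w wn PE] := mixed_placementP PM; exists w => //.
    by rewrite mem_filter wn -(placement_mixed k wn) -PE PM.
  by rewrite mem_filter => /andP[wk wn] ->; rewrite placement_mixed.
rewrite big_map big_seq [RHS]big_seq; apply: eq_bigr => w.
by rewrite mem_filter => /andP[_ wn]; rewrite unc_placement.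
Qed.

(** * Insertion of the maximum in a permutation *)

(** The position [p] is the preimage of the maximum, which gives injectivity; both sides have (n+1)!
    elements. *)
Lemma lift_perm_max_bij n :
  bijective (fun ps : 'I_n.+1 * 'S_n => lift_perm ps.1 ord_max ps.2).
Proof.
apply: inj_card_bij => [[p s] [p' s'] /= e|]; last first.
  by rewrite card_prod card_ord !card_Sn factS.
have pp' : p = p'.
  by apply: (@perm_inj _ (lift_perm p' ord_max s')); rewrite lift_perm_id -e lift_perm_id.
congr (_, _) => //; apply/permP => i; apply: (@lift_inj _ ord_max).
by rewrite -(lift_perm_lift p) e -pp' lift_perm_lift.
Qed.

Lemma sum_lift_perm_max (V : nmodType) n (G : 'S_n.+1 -> V) :
  \sum_s G s = \sum_(s : 'S_n) \sum_(p < n.+1) G (lift_perm p ord_max s).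
Proof.
rewrite exchange_big (reindex _ (onW_bij _ (lift_perm_max_bij n))).
by rewrite -(pair_bigA _ (fun p s => G (lift_perm p ord_max s))).
Qed.

(** A total function on [nat], 0 beyond the last position, so that words of different lengths are
    compared without casts between ordinals. *)
Definition perm_word n (s : 'S_n) (x : nat) : nat :=
  oapp (fun i => val (s i)) 0%N (insub x).

Lemma perm_wordE n (s : 'S_n) (i : 'I_n) : perm_word s i = s i.
Proof. by rewrite /perm_word valK. Qed.

Lemma ltn_perm_word n (s : 'S_n.+1) x : (perm_word s x < n.+1)%N.
Proof. by rewrite /perm_word; case: insubP => //= i _ _; rewrite ltn_ord. Qed.

Definition insert n p (f : nat -> nat) x : nat :=
  if (x < p)%N then f x else if x == p then n else f x.-1.

Lemma insert_lt n p f x : (x < p)%N -> insert n p f x = f x.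
Proof. by rewrite /insert => ->. Qed.

Lemma insert_eq n p f : insert n p f p = n.
Proof. by rewrite /insert ltnn eqxx. Qed.

Lemma insert_gt n p f x : (p <= x)%N -> insert n p f x.+1 = f x.
Proof. by move=> px; rewrite /insert ltnNge leqW //= gtn_eqF. Qed.

Lemma perm_word_lift_perm n (p : 'I_n.+1) (s : 'S_n) :
  perm_word (lift_perm p ord_max s) =1 insert n p (perm_word s).
Proof.
move=> x; rewrite /insert {1}/perm_word; case: insubP => /= [i _ <-{x}|xn].
  case: (unliftP p i) => [j|] ->; last by rewrite lift_perm_id ltnn eqxx.
  rewrite lift_perm_lift /= /bump leqNgt ltn_ord add0n.
  case: (leqP p j) => pj /=; last by rewrite add0n pj perm_wordE.
  by rewrite add1n ltnNge leqW //= gtn_eqF // perm_wordE.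
(* Beyond the last position both sides are the default 0, as [insert] reads the old word at
   [x.-1 >= n]. *)
have px : (p < x)%N by rewrite (leq_trans (ltn_ord p)) // leqNgt.
rewrite ltnNge ltnW //= gtn_eqF // /perm_word insubF //.
by case: x px xn => // x _; rewrite ltnS /= => /negbTE.
Qed.

(** * Descents after insertion of a new maximum *)

Definition desc (f : nat -> nat) (i : nat) : bool := (f i.+1 < f i)%N.

Definition box (f : nat -> nat) (j : nat) : nat :=
  (\sum_(0 <= i < j) (f j < f i))%N.

Section BigDes.

Variables (R : Type) (idx : R) (op : Monoid.com_law idx).
Implicit Type (F : nat -> R).

(** The last position has no successor, so the range stops at [n]. The general law [op] covers both
    the sums such as [maj] and the products in the weights. *)
Lemma big_Des n (s : 'S_n.+1) F :
  \big[op/idx]_(i in Des s) F i = \big[op/idx]_(0 <= i < n | desc (perm_word s) i) F i.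
Proof.
rewrite big_mkcond big_ord_recr /= ifF ?Monoid.mulm1; last first.
  apply/negP; rewrite inE => /existsP[j /andP[/eqP jE _]].
  by have := ltn_ord j; rewrite jE ltnn.
rewrite [RHS]big_mkcond big_mkord; apply: eq_bigr => i _; congr (if _ then _ else _).
have wi : perm_word s i = s (widen_ord (leqnSn n) i) by rewrite -perm_wordE.
have wi1 : perm_word s i.+1 = s (lift ord0 i) by rewrite -perm_wordE.
rewrite inE /desc wi wi1; apply/existsP/idP => [[j /andP[/eqP ji]]|lt].
  by rewrite (_ : j = lift ord0 i) //; apply: val_inj.
by exists (lift ord0 i); rewrite lt /= eqxx.
Qed.

Variables (m : nat) (f f' : nat -> nat).
Hypothesis fm : forall i, (f i < m.+1)%N.

Lemma big_desc_insert0 F : f' =1 insert m.+1 0 f ->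
  \big[op/idx]_(0 <= i < m.+1 | desc f' i) F i
  = op (F 0%N) (\big[op/idx]_(0 <= i < m | desc f i) F i.+1).
Proof.
move=> f'E; rewrite big_ltn_cond // ifT; last by rewrite /desc !f'E /insert /= fm.
by rewrite big_add1 /=; congr (op _ _); apply: eq_bigl => i; rewrite /desc !f'E.
Qed.

(** A maximum placed between positions [x] and [x.+1] turns [x] into an ascent, makes [x.+1] a
    descent and shifts the later descents by one. *)
Lemma big_desc_insertS x F : (x < m)%N -> f' =1 insert m.+1 x.+1 f ->
  \big[op/idx]_(0 <= i < m.+1 | desc f' i) F i
  = op (\big[op/idx]_(0 <= i < x | desc f i) F i)
       (op (F x.+1) (\big[op/idx]_(x.+1 <= i < m | desc f i) F i.+1)).
Proof.
move=> xm f'E; rewrite (@big_cat_nat _ _ _ x) ?leqW ?(ltnW xm) //=; congr (op _ _).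
  rewrite big_nat_cond [RHS]big_nat_cond; apply: eq_bigl => i.
  case ix : (i < x)%N; rewrite ?andbF // /desc !f'E !insert_lt //.
  by rewrite ltnW.
rewrite big_ltn_cond ?leqW // ifF; last first.
  by apply/negbTE; rewrite /desc !f'E insert_eq insert_lt // -leqNgt ltnW.
rewrite big_ltn_cond // ifT; last by rewrite /desc !f'E insert_eq insert_gt.
congr (op _ _); rewrite big_add1 /= big_nat_cond [RHS]big_nat_cond; apply: eq_bigl => i.
case: (boolP (x < i)%N) => xi //=.
by rewrite /desc !f'E !insert_gt // ltnW.
Qed.

Lemma big_desc_insert_last F : f' =1 insert m.+1 m.+1 f ->
  \big[op/idx]_(0 <= i < m.+1 | desc f' i) F i
  = \big[op/idx]_(0 <= i < m | desc f i) F i.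
Proof.
move=> f'E; rewrite big_mkcond big_nat_recr //= ifF ?Monoid.mulm1.
  rewrite -big_mkcond big_nat_cond [RHS]big_nat_cond; apply: eq_bigl => i.
  case im : (i < m)%N; rewrite ?andbF // /desc !f'E !insert_lt //.
  by rewrite ltnW.
by apply/negbTE; rewrite /desc !f'E insert_eq insert_lt // -leqNgt ltnW.
Qed.

(** A commutative fold over a prefix containing the inserted letter does not see where that letter
    stands. *)
Lemma big_insert p N (F : nat -> R) : f' =1 insert m.+1 p f -> (p <= N)%N ->
  \big[op/idx]_(0 <= i < N.+1) F (f' i)
  = op (\big[op/idx]_(0 <= i < N) F (f i)) (F m.+1).
Proof.
move=> f'E; elim: N => [|N IH]; rewrite leq_eqVlt.
  by rewrite orbF => /eqP p0; rewrite big_nat1 big_geq // f'E p0 insert_eq Monoid.mul1m.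
case/predU1P=> [pE|pN].
  rewrite big_nat_recr //= f'E -{2}pE insert_eq; congr (op _ _).
  rewrite big_nat [RHS]big_nat; apply: eq_bigr => i /= ip.
  by rewrite f'E insert_lt // pE.
rewrite big_nat_recr //= IH // f'E insert_gt //.
by rewrite [in RHS]big_nat_recr //= Monoid.mulmAC.
Qed.

End BigDes.

Lemma inv_boxE n (s : 'S_n) (j : 'I_n) : inv_box s j = box (perm_word s) j.
Proof.
rewrite /inv_box /box -sum1_card (big_nat_widen _ _ n) 1?ltnW // big_mkord.
rewrite [RHS]big_mkcond [LHS]big_mkcond; apply: eq_bigr => i _ /=.
by rewrite inE !perm_wordE; case: (i < j)%N; case: (s j < s i)%N.
Qed.

Lemma perm_invE n (s : 'S_n) : Defs.perm_inv s = (\sum_(0 <= j < n) box (perm_word s) j)%N.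
Proof. by rewrite inv_sum_box big_mkord; apply: eq_bigr => j _; rewrite inv_boxE. Qed.

Lemma majE n (s : 'S_n.+1) : maj s = (\sum_(0 <= i < n | desc (perm_word s) i) i.+1)%N.
Proof. exact: (big_Des _ s S). Qed.

Lemma des_fromE n (s : 'S_n.+1) (i : 'I_n.+1) :
  des_from s i = (\sum_(i <= j < n | desc (perm_word s) j) 1)%N.
Proof.
rewrite /des_from -sum1_card.
rewrite (eq_bigl (fun j : 'I_n.+1 => (j \in Des s) && (i <= j)%N)); last first.
  by move=> j; rewrite inE.
rewrite big_mkcondr (big_Des _ s (fun j => if (i <= j)%N then 1%N else 0%N)).
have [iN|iN] := leqP i n.
  rewrite (@big_cat_nat _ _ _ i) //= [X in (X + _)%N]big_nat_cond big1 ?add0n.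
    by rewrite big_nat_cond [RHS]big_nat_cond; apply: eq_bigr => j /andP[/andP[->]].
  by move=> j /andP[/= ji _]; rewrite leqNgt ji.
by have := ltn_ord i; rewrite ltnNge iN.
Qed.

(** * Inversions after insertion of a new maximum *)

Section InsertBox.

Variables (m p : nat) (f f' : nat -> nat).
Hypotheses (fm : forall i, (f i < m.+1)%N) (f'E : f' =1 insert m.+1 p f).

Lemma box_insert_lt j : (j < p)%N -> box f' j = box f j.
Proof.
move=> jp; rewrite /box !big_nat; apply: eq_bigr => i /= ij.
by rewrite !f'E !insert_lt // (ltn_trans ij jp).
Qed.

Lemma box_insert_eq : box f' p = 0%N.
Proof.
rewrite /box big_nat big1 // => i /= ip.
by rewrite !f'E insert_eq insert_lt // ltnNge ltnW.
Qed.

Lemma box_insert_gt j : (p <= j)%N -> box f' j.+1 = (box f j).+1.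
Proof.
move=> pj; rewrite /box (big_insert _ (fun v => nat_of_bool (f' j.+1 < v)%N) f'E pj).
by rewrite f'E insert_gt //= fm addn1.
Qed.

(** The maximum has nothing larger before it, and each of the [N - p] letters after it gains one
    larger letter on its left. *)
Lemma sum_box_insert N : (p <= N)%N ->
  (\sum_(0 <= j < N.+1) box f' j = \sum_(0 <= j < N) box f j + (N - p))%N.
Proof.
elim: N => [|N IH]; rewrite leq_eqVlt.
  by rewrite orbF => /eqP p0; rewrite big_nat1 big_geq // -p0 box_insert_eq p0.
case/predU1P=> [pE|pN].
  rewrite big_nat_recr //= -pE box_insert_eq subnn; congr addn.
  by rewrite !big_nat; apply: eq_bigr => j /= jp; rewrite box_insert_lt.
rewrite big_nat_recr //= IH // box_insert_gt // [in RHS]big_nat_recr //= subSn //.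
lia.
Qed.

End InsertBox.

(** * The recurrence for the permutation statistics *)

Section Recurrences.

Variables (K : fieldType) (q : K).
Hypothesis q0 : q != 0.

(** The generating function G_s(z): in a field, costs become divisions and the sum over star sets
    factors. *)
Definition starred_weight n (stat : 'S_n -> nat) (cost : 'S_n -> 'I_n -> nat)
    (z : K) (s : 'S_n) : K :=
  q ^+ stat s * \prod_(i in Des s) (1 + z / q ^+ cost s i).

Definition inv_weight n :=
  starred_weight (@Defs.perm_inv n) (fun s i => (1 + inv_box s i)%N).

Definition maj_weight n := starred_weight (@maj n) (@des_from n).

(** The first and last insertions follow formulas of their own; the inner ones telescope after
    multiplication by [w], which will be [q - 1]. *)
Lemma sum_insertions m (t : 'I_m.+2 -> K) (h0 hlast : K) (h T : nat -> K) (w : K) :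
  t ord0 = h0 -> t ord_max = hlast ->
  (forall p : 'I_m.+2, forall x, (x < m)%N -> p = x.+1 :> nat -> t p = h x) ->
  (forall x, (x < m)%N -> h x * w = T x.+1 - T x) ->
  (\sum_p t p) * w = h0 * w + (T m - T 0%N) + hlast * w.
Proof.
move=> t0 tl th hT; rewrite big_ord_recl big_ord_recr /= t0.
rewrite (_ : lift ord0 ord_max = ord_max) ?tl; last exact: val_inj.
rewrite addrA !mulrDl; congr (_ + _ + _).
rewrite -telescope_sumr // mulr_suml big_mkord; apply: eq_bigr => x _.
by rewrite -hT // (th _ x).
Qed.

(** Insertion at [p] adds m+1-p inversions. Descents on its left keep their factors, a new descent
    at [p] has the factor 1 + z/q, and each descent on its right has one more larger letter before
    it, which replaces z by z/q. *)
Lemma sum_inv_weight m (s : 'S_m.+1) z :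
  (\sum_(p < m.+2) inv_weight z (lift_perm p ord_max s)) * (q - 1)
  = q ^+ m.+2 * ((1 + z / q) * inv_weight (z / q) s) - (1 + z) * inv_weight z s.
Proof.
pose f := perm_word s; pose I := Defs.perm_inv s.
have fm i : (f i < m.+1)%N by apply: ltn_perm_word.
pose g (z : K) i := 1 + z / q ^+ (1 + box f i).
pose L x := \prod_(0 <= i < x | desc f i) g z i.
pose R x := \prod_(x <= i < m | desc f i) g (z / q) i.
have gq i : 1 + z / q ^+ (1 + (box f i).+1) = g (z / q) i.
  by rewrite /g (addnS 1) exprS invfM mulrA.
have wE y : inv_weight y s = q ^+ I * \prod_(0 <= i < m | desc f i) g y i.
  rewrite -(big_Des _ s (g y)); congr (_ * _); apply: eq_bigr => i _.
  by rewrite inv_boxE.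
have tE (p : 'I_m.+2) : inv_weight z (lift_perm p ord_max s)
    = q ^+ (I + (m.+1 - p))
      * \prod_(0 <= i < m.+1 | desc (perm_word (lift_perm p ord_max s)) i)
          (1 + z / q ^+ (1 + box (perm_word (lift_perm p ord_max s)) i)).
  rewrite -big_Des /inv_weight /starred_weight perm_invE.
  rewrite (sum_box_insert fm (perm_word_lift_perm p s)); last by rewrite -ltnS.
  rewrite -perm_invE; congr (_ * _); apply: eq_bigr => i _.
  by rewrite inv_boxE.
have RS x : (x < m)%N -> R x = (if desc f x then g (z / q) x else 1) * R x.+1.
  by move=> xm; rewrite /R big_ltn_cond //; case: ifP; rewrite ?mul1r.
have LS x : L x.+1 = L x * (if desc f x then g z x else 1).
  by rewrite /L big_mkcond big_nat_recr //= -big_mkcond.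
(* Moving from [x] to [x.+1] trades one factor of [R] for one of [L]. If [x] is a descent, the
   difference rests on q (1 + z/q^(c+1)) - (1 + z/q^c) = q - 1 with c = 1 + [box f x]; otherwise on
   q * 1 - 1. *)
pose T x := - (q ^+ (I + (m.+1 - x)) * (1 + z / q) * L x * R x).
rewrite (@sum_insertions m _ (q ^+ (I + m.+1) * ((1 + z / q) * R 0%N))
   (q ^+ I * L m) (fun x => q ^+ (I + (m - x)) * (L x * ((1 + z / q) * R x.+1))) T).
(* In the boundary terms, [L m] and [R 0] are the complete products, at [z] and at [z / q]. *)
- have L0 : L 0%N = 1 by rewrite /L big_geq.
  have Rm : R m = 1 by rewrite /R big_geq.
  rewrite !wE -/(L m) -/(R 0%N) /T L0 Rm subn0 subSnn !exprD !exprS expr0.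
  by field.
- rewrite tE (big_desc_insert0 _ fm _ (perm_word_lift_perm ord0 s)).
  rewrite (box_insert_eq fm (perm_word_lift_perm _ s)) subn0 addn0 expr1; congr (_ * (_ * _)).
  apply: eq_bigr => i _.
  by rewrite (box_insert_gt fm (perm_word_lift_perm _ s)) // gq.
- rewrite tE subnn addn0 (big_desc_insert_last _ fm _ (perm_word_lift_perm ord_max s)).
  congr (_ * _); rewrite /L big_nat_cond [RHS]big_nat_cond; apply: eq_bigr => i /andP[im _].
  by rewrite (box_insert_lt (perm_word_lift_perm _ s)) //= ltnW.
- move=> p x xm pE.
  have := perm_word_lift_perm p s; have := tE p; rewrite pE => -> fE.
  rewrite (big_desc_insertS _ fm _ xm fE) subSS; congr (_ * _).
  rewrite (box_insert_eq fm fE) addn0 expr1 /L; congr (_ * (_ * _)).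
    rewrite big_nat_cond [RHS]big_nat_cond; apply: eq_bigr => i /andP[/= ix _].
    by rewrite (box_insert_lt fE) // ltnW.
  rewrite big_nat_cond [RHS]big_nat_cond; apply: eq_bigr => i /andP[/andP[xi _] _].
  by rewrite (box_insert_gt fm fE) // gq.
move=> x xm; rewrite /T (RS x xm) (LS x) subSS subSn 1?ltnW // addnS exprS.
by case: ifP => _; rewrite /g ?add1n ?exprS; field; rewrite ?expf_neq0 ?q0.
Qed.

(** The Pochhammer symbol (-z/q; 1/q)_d. *)
Definition starP d (z : K) := \prod_(1 <= r < d.+1) (1 + z / q ^+ r).

Lemma starPS d z : q ^+ d.+1 * starP d.+1 z = (q ^+ d.+1 + z) * starP d z.
Proof.
rewrite /starP big_nat_recr //= mulrCA [RHS]mulrC; congr (_ * _).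
by rewrite mulrDr mulr1 mulrCA divff ?mulr1 // expf_neq0.
Qed.

Lemma starP_div d z : (1 + z / q) * starP d (z / q) = starP d.+1 z.
Proof.
rewrite /starP [RHS]big_nat_recl // expr1 !big_add1 /=; congr (_ * _).
by apply: eq_bigr => i _; rewrite [q ^+ i.+2]exprS invfM mulrA.
Qed.

(** Counted from the right, the r-th descent costs r, so the product depends only on the number of
    descents. The induction is on the length of the final segment, as a cost sees nothing to its
    left. *)
Lemma prod_des_from (D : pred nat) m z :
  \prod_(0 <= i < m | D i) (1 + z / q ^+ (\sum_(i <= j < m | D j) 1))
  = starP (\sum_(0 <= j < m | D j) 1) z.
Proof.
suff H k : (k <= m)%N ->
    \prod_(m - k <= i < m | D i) (1 + z / q ^+ (\sum_(i <= j < m | D j) 1))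
    = starP (\sum_(m - k <= j < m | D j) 1) z.
  by have := H m (leqnn m); rewrite subnn.
elim: k => [_|k IH km]; first by rewrite subn0 !big_geq // /starP big_geq.
have lt : (m - k.+1 < m)%N by rewrite ltn_subrL (leq_ltn_trans _ km).
rewrite big_ltn_cond // [in RHS]big_ltn_cond // subnSK // IH 1?ltnW //.
case: ifP => // Dk; rewrite big_ltn_cond // Dk subnSK //.
by rewrite add1n mulrC /starP [RHS]big_nat_recr.
Qed.

(** Only [maj] and the number of descents matter. Insertion at [x.+1] keeps [d] descents and adds
    [c x] to [maj] if [x] is a descent; otherwise it gives [d.+1] descents and adds
    [x + 2 + c x]. *)
Lemma sum_maj_weight m (s : 'S_m.+1) z :
  (\sum_(p < m.+2) maj_weight z (lift_perm p ord_max s)) * (q - 1)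
  = q ^+ m.+2 * ((1 + z / q) * maj_weight (z / q) s) - (1 + z) * maj_weight z s.
Proof.
pose f := perm_word s; pose M := maj s.
have fm i : (f i < m.+1)%N by apply: ltn_perm_word.
pose c x := (\sum_(x <= j < m | desc f j) 1)%N.
pose d := c 0%N.
have wE n (s' : 'S_n.+1) y : maj_weight y s'
    = q ^+ (\sum_(0 <= i < n | desc (perm_word s') i) i.+1)
      * starP (\sum_(0 <= i < n | desc (perm_word s') i) 1) y.
  rewrite /maj_weight /starred_weight majE -prod_des_from; congr (_ * _).
  rewrite -(big_Des _ s'
    (fun i => 1 + y / q ^+ (\sum_(i <= j < n | desc (perm_word s') j) 1))).
  by apply: eq_bigr => i _; rewrite des_fromE.
have cS x : (x < m)%N -> c x = (desc f x + c x.+1)%N.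
  by move=> xm; rewrite /c big_ltn_cond //; case: ifP.
have sum_split (F : nat -> nat) x : (x <= m)%N ->
    (\sum_(0 <= i < x | desc f i) F i + \sum_(x <= i < m | desc f i) F i
     = \sum_(0 <= i < m | desc f i) F i)%N by move=> xm; rewrite -big_cat_nat.
have shift x : (\sum_(x <= i < m | desc f i) i.+2
    = \sum_(x <= i < m | desc f i) i.+1 + c x)%N.
  by rewrite /c -big_split; apply: eq_bigr => i _; rewrite /= addn1.
have ME : M = (\sum_(0 <= i < m | desc f i) i.+1)%N by rewrite /M majE.
(* If [x] is a descent, [c] drops by one and the terms in [starP d.+1 z] cancel in [T x.+1 - T x];
   otherwise [c] is unchanged and those in [starP d z] cancel. *)
pose T x := q ^+ M * (q ^+ (x + 2 + c x) * starP d.+1 z - q ^+ (c x + 1) * starP d z).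
rewrite (@sum_insertions m _ (q ^+ (M + d.+1) * starP d.+1 z) (q ^+ M * starP d z)
   (fun x => if desc f x then q ^+ (M + c x) * starP d z
             else q ^+ (M + (x + 2 + c x)) * starP d.+1 z) T).
- have -> : maj_weight z s = q ^+ M * starP d z by rewrite wE -ME.
  have -> : maj_weight (z / q) s = q ^+ M * starP d (z / q) by rewrite wE -ME.
  rewrite [(1 + z / q) * _]mulrCA starP_div /T.
  have -> : c m = 0%N by rewrite /c big_geq.
  rewrite -/d addn0 add0n addnS exprD.
  (* This trades [z * starP d z] for [starP d.+1 z], so that the boundary terms can be compared. *)
  have := starPS d z => W.
  have -> : (1 + z) * (q ^+ M * starP d z)
    = q ^+ M * (q ^+ d.+1 * starP d.+1 z - q ^+ d.+1 * starP d z + starP d z).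
    by rewrite W; ring.
  rewrite !exprD !exprS expr0 exprD; ring.
- have fE := perm_word_lift_perm ord0 s.
  rewrite wE !(big_desc_insert0 _ fm _ fE) shift ME.
  by congr (q ^+ _ * starP _ _); rewrite addnS.
- have fE := perm_word_lift_perm ord_max s.
  by rewrite wE !(big_desc_insert_last _ fm _ fE) -ME.
- move=> p x xm pE; have := perm_word_lift_perm p s; rewrite pE => fE.
  rewrite wE !(big_desc_insertS _ fm _ xm fE) shift.
  have MS := sum_split S x (ltnW xm); have DS := sum_split (fun=> 1%N) x (ltnW xm).
  move: MS DS; rewrite -ME -/(c x) -/(c 0%N) -/d (cS x xm).
  rewrite [X in (_ + X)%N = M]big_ltn_cond //.
  by case: ifP => _ /= MS DS; congr (_ ^+ _ * starP _ _); rewrite -?/(c x.+1); lia.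
move=> x xm; rewrite /T cS //; case: (desc f x) => /=.
  by rewrite !exprD ?add1n ?add0n !exprS expr0; ring.
by rewrite !exprD ?add0n !exprS expr0; ring.
Qed.

End Recurrences.

(** * Summation over star sets *)

Lemma sum_starred_weight (K : fieldType) (q : K) (q0 : q != 0) n
    (stat : 'S_n -> nat) (cost : 'S_n -> 'I_n -> nat) z :
  (forall k p, p \in starred n k -> (\sum_(i in p.2) cost p.1 i <= stat p.1)%N) ->
  \sum_s starred_weight q stat cost z s
  = \sum_(k < n.+1)
      (\sum_(p in starred n k) q ^+ (stat p.1 - \sum_(i in p.2) cost p.1 i)) * z ^+ k.
Proof.
move=> cost_le.
transitivity (\sum_(p : 'S_n * {set 'I_n} | p.2 \subset Des p.1)
   q ^+ (stat p.1 - \sum_(i in p.2) cost p.1 i) * z ^+ #|p.2|).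
  rewrite -(pair_big_dep xpredT (fun (s : 'S_n) (S : {set 'I_n}) => S \subset Des s)
    (fun (s : 'S_n) (S : {set 'I_n}) => q ^+ (stat s - \sum_(i in S) cost s i) * z ^+ #|S|)) /=.
  apply: eq_bigr => s _; rewrite /starred_weight big_mkcond /=.
  (* With the factor 0 + 1 at non-descents, the product runs over all positions and distributes into
     a sum over all subsets; those outside [Des s] contribute 0. *)
  rewrite (eq_bigr (fun i => (if i \in Des s then z / q ^+ cost s i else 0) + 1)); last first.
    by move=> i _; case: ifP; rewrite ?add0r // addrC.
  rewrite bigA_distr mulr_sumr [RHS]big_mkcond; apply: eq_bigr => S _ /=.
  rewrite -big_mkcond /=; case: ifP => [sub|/subsetPn[i iS iD]]; last first.
    by rewrite (bigD1 i) //= (negbTE iD) mul0r mulr0.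
  (* This makes the subtraction in the exponent exact, so that it agrees with division in [K]. *)
  have le : (\sum_(i in S) cost s i <= stat s)%N.
    by apply: (cost_le #|S| (s, S)); rewrite inE sub /=.
  rewrite (eq_bigr (fun i => z / q ^+ cost s i)); last first.
    by move=> i /(subsetP sub) ->.
  rewrite big_split /= prodr_const prodfV prodrXr -{1}(subnK le) exprD.
  by rewrite mulrCA -!mulrA divff ?expf_neq0 // mulr1 mulrC.
rewrite (partition_big (fun p : 'S_n * {set 'I_n} => inord #|p.2| : 'I_n.+1) xpredT) //=.
apply: eq_bigr => k _; rewrite mulr_suml.
have card_lt (p : 'S_n * {set 'I_n}) : (#|p.2| < n.+1)%N.
  by rewrite ltnS (leq_trans (max_card _)) ?card_ord.
apply: eq_big => [p|p /andP[_ /eqP <-]]; last by rewrite inordK.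
by rewrite inE -val_eqE /= inordK.
Qed.

(** * Comparison with the rook sums, in a field where [q] and [q - 1] are invertible *)

Section Specialization.

Variables (K : fieldType) (phi : {rmorphism {poly int} -> K}).
Hypothesis phi_inj : injective phi.

Local Notation q := (phi 'X).

Lemma phiX_neq0 : q != 0.
Proof. by rewrite -(rmorph0 phi) (inj_eq phi_inj) polyX_eq0. Qed.

Lemma expr_phiX_inj : injective (fun i => q ^+ i).
Proof.
move=> i j; rewrite -!rmorphXn => /phi_inj/(congr1 (size : {poly int} -> nat)).
by rewrite !size_polyXn => -[].
Qed.

(** The difference is a polynomial of size at most [n] vanishing at the [n] distinct points q^0,
    ..., q^(n-1). *)
Lemma eval_inj n (a b : nat -> K) :
  (forall z, \sum_(k < n) a k * z ^+ k = \sum_(k < n) b k * z ^+ k) ->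
  forall k, (k < n)%N -> a k = b k.
Proof.
move=> ab; suff /polyP pE : \poly_(k < n) a k - \poly_(k < n) b k = 0.
  by move=> k kn; apply/eqP; have := pE k; rewrite coefB !coef_poly kn coef0 -subr_eq0 => ->.
apply: (@roots_geq_poly_eq0 _ _ [seq q ^+ i | i <- iota 0 n]).
- by apply/allP => z _; rewrite rootE hornerD hornerN !horner_poly ab subrr.
- by rewrite map_inj_uniq ?iota_uniq //; exact: expr_phiX_inj.
rewrite size_map size_iota (leq_trans (size_polyD _ _)) // geq_max size_polyN.
by rewrite !size_poly.
Qed.

Lemma qintB1 m : phi (qint m) * (q - 1) = q ^+ m - 1.
Proof.
rewrite mulrC subrX1 /qint rmorph_sum; congr (_ * _); apply: eq_bigr => i _.
by rewrite /= rmorphXn.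
Qed.

(** The coefficients of (1 + z) A_n(z) are [b k] = a(n, k) + a(n, k-1). Replacing z by z/q divides
    them by q^k, and (q^(n+1-k) - 1) [b k] = (q - 1) [n+1-k] [b k] = (q - 1) a(n+1, k). *)
Lemma rook_polyS n z :
  (\sum_(k < n.+2) phi (rook_sum n.+1 k) * z ^+ k) * (q - 1)
  = q ^+ n.+1 * ((1 + z / q) * \sum_(k < n.+1) phi (rook_sum n k) * (z / q) ^+ k)
    - (1 + z) * \sum_(k < n.+1) phi (rook_sum n k) * z ^+ k.
Proof.
pose b k := rook_sum n k + (if k is k'.+1 then rook_sum n k' else 0).
have bE y : (1 + y) * \sum_(k < n.+1) phi (rook_sum n k) * y ^+ k
    = \sum_(k < n.+2) phi (b k) * y ^+ k.
  rewrite mulrDl mul1r (eq_bigr (fun k : 'I_n.+2 => phi (rook_sum n k) * y ^+ k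
      + phi (if val k is k'.+1 then rook_sum n k' else 0) * y ^+ k)); last first.
    by move=> k _; rewrite rmorphD mulrDl.
  rewrite big_split /=; congr (_ + _).
    by rewrite [RHS]big_ord_recr /= rook_sum_gt // rmorph0 mul0r addr0.
  rewrite [RHS]big_ord_recl /= rmorph0 mul0r add0r mulr_sumr; apply: eq_bigr => k _.
  by rewrite /= exprS mulrCA.
rewrite !bE mulr_sumr mulr_suml -sumrB; apply: eq_bigr => k _.
have -> : rook_sum n.+1 k = qint (n.+1 - k) * b k.
  by rewrite rook_sumS /b; case: (val k) => [|k']; rewrite ?addr0 // subSS mulrDr.
have kn : (k <= n.+1)%N by rewrite -ltnS.
transitivity (phi (b k) * z ^+ k * (q ^+ (n.+1 - k) - 1)).
  by rewrite -qintB1 rmorphM; ring.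
rewrite mulrBr mulr1 expr_div_n; congr (_ - _).
have -> : q ^+ n.+1 = q ^+ (n.+1 - k) * q ^+ k by rewrite -exprD subnK.
field.
by rewrite expf_neq0 ?phiX_neq0.
Qed.

(** Summed over [s], the insertion identity becomes [rook_polyS]; induction on the size applies at
    both [z] and [z / q], and [q - 1] cancels. *)
Lemma sum_weightE (wt : forall n, K -> 'S_n -> K) m z :
  (forall z (s : 'S_1), wt 1%N z s = 1) ->
  (forall m (s : 'S_m.+1) z,
     (\sum_(p < m.+2) wt _ z (lift_perm p ord_max s)) * (q - 1)
     = q ^+ m.+2 * ((1 + z / q) * wt _ (z / q) s) - (1 + z) * wt _ z s) ->
  \sum_s wt m.+1 z s = \sum_(k < m.+2) phi (rook_sum m.+1 k) * z ^+ k.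
Proof.
move=> wt1 wtS; elim: m z => [|m IH] z.
  rewrite (eq_bigr (fun=> 1)) => [|s _]; last exact: wt1.
  rewrite sumr_const card_Sn big_ord_recl big_ord1 /= !rook_sumE //.
  rewrite subnn /= qint0 mul0r mulr0 rmorph0 mul0r addr0 mulr0 addr0 mulr1 expr0.
  by rewrite subn0 /qfact big_nat1 /qint big_ord1 /= expr0 (rmorph1 phi) mulr1.
have q1 : q - 1 != 0.
  by apply/negP; rewrite subr_eq0 => /eqP/(@expr_phiX_inj 1%N 0%N).
apply: (mulIf q1); rewrite rook_polyS -!IH sum_lift_perm_max mulr_suml.
by under eq_bigr do rewrite wtS; rewrite sumrB !mulr_sumr.
Qed.

Lemma sum_starredE m k (stat : forall n, 'S_n -> nat)
    (cost : forall n, 'S_n -> 'I_n -> nat) :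
  (forall n k (p : 'S_n * {set 'I_n}), p \in starred n k ->
     (\sum_(i in p.2) cost n p.1 i <= stat n p.1)%N) ->
  (forall s : 'S_1, stat 1%N s = 0%N) ->
  (forall m (s : 'S_m.+1) z,
     (\sum_(p < m.+2) starred_weight q (@stat _) (@cost _) z (lift_perm p ord_max s))
       * (q - 1)
     = q ^+ m.+2 * ((1 + z / q) * starred_weight q (@stat _) (@cost _) (z / q) s)
       - (1 + z) * starred_weight q (@stat _) (@cost _) z s) ->
  (k <= m.+1)%N ->
  \sum_(p in starred m.+1 k) 'X^(stat _ p.1 - \sum_(i in p.2) cost _ p.1 i)
  = rook_sum m.+1 k.
Proof.
move=> cost_le stat1 wtS km; apply: phi_inj; rewrite rmorph_sum.
under eq_bigr do rewrite /= rmorphXn.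
apply: (eval_inj (n := m.+2) (a := fun k => \sum_(p in starred m.+1 k)
  q ^+ (stat _ p.1 - \sum_(i in p.2) cost _ p.1 i))
  (b := fun k => phi (rook_sum m.+1 k))) => // z.
rewrite -sum_starred_weight; [|exact: phiX_neq0|exact: cost_le].
apply: (sum_weightE (wt := fun n => starred_weight q (@stat n) (@cost n))) => // {}z s.
rewrite /starred_weight stat1 expr0 mul1r.
(* [big_Des] expects a function on [nat], obtained through [inord]; at size 1 its range is empty and
   the weight is 1. *)
under eq_bigr => i _ do rewrite -[i in cost _ _ i]inord_val.
by rewrite (big_Des _ s (fun i => 1 + z / q ^+ cost _ s (inord i))) big_geq.
Qed.

End Specialization.

Theorem theorem4p2p1 (n k : nat) (hn : (1 <= n)%N) (hk : (k <= n - 1)%N) :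
  [/\ \sum_(p in starred n k) 'X^(starred_inv p)
        = \sum_(p in starred n k) 'X^(starred_maj p) :> {poly int},
      \sum_(p in starred n k) 'X^(starred_maj p)
        = \sum_(P in mixed_placements n k) 'X^(unc P) :> {poly int}
    & \sum_(P in mixed_placements n k) 'X^(unc P)
        = qfact (n - k) * qStirling n (n - k) :> {poly int}].
Proof.
have kn : (k <= n)%N by rewrite (leq_trans hk) ?leq_subr.
rewrite sum_mixed_placements -rook_sumE //.
case: n hn kn {hk} => // m _ km.
(* The field is the fraction field of [{poly int}]. *)
have tofrac_inj : injective (@tofrac {poly int}).
  by move=> a b /eqP; rewrite tofrac_eq => /eqP.
have -> : \sum_(p in starred m.+1 k) 'X^(starred_inv p) = rook_sum m.+1 k.
  apply: (sum_starredE (cost := fun n s i => (1 + inv_box s i)%N) tofrac_inj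
    starred_inv_le) => //; last exact: sum_inv_weight (phiX_neq0 tofrac_inj).
  by move=> s; rewrite perm_invE big_nat1 /box big_geq.
have -> // : \sum_(p in starred m.+1 k) 'X^(starred_maj p) = rook_sum m.+1 k.
apply: (sum_starredE tofrac_inj starred_maj_le) => //.
  by move=> s; rewrite majE big_geq.
exact: sum_maj_weight (phiX_neq0 tofrac_inj).
Qed.
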